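(* Let $\rho$ be a state of exactly $M$ particles in total distributed among $N\ge2$ parties, each holding one or more local modes. If $M<N$, then $\rho$ cannot violate any genuinely multipartite Bell inequality using local measurements that obey the particle-number superselection rule. That is, for any family of local POVMs $\{E^{(j)}_{x_j|a_j}\}_{x_j}$ of party $j$ ($a_j$ ranging over a finite set of measurement settings, finitely many outcomes $x_j$), all of whose elements commute with party $j$'s particle-number operator, the correlations $$p(x_1,\dots,x_N|a_1,\dots,a_N)=\mathrm{Tr}\Big[\rho\,\bigotimes_{j=1}^N E^{(j)}_{x_j|a_j}\Big]$$ are of the form $$\sum_{S}q_S\int d\lambda\,\rho_S(\lambda)\,p_S(x_S|a_S,\lambda)\,p_{S^c}(x_{S^c}|a_{S^c},\lambda),$$ with the sum over nonempty proper subsets $S$ of $\{1,\dots,N\}$, $q_S\ge0$, $\sum_Sq_S=1$.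
   Context: For a subset $S$ of parties, $x_S,a_S$ denote the tuples of outcomes and settings of the parties in $S$, $S^c$ is the complement of $S$, each $\rho_S(\lambda)$ is a probability distribution of a hidden variable $\lambda$, and $p_S(\cdot|a_S,\lambda)$, $p_{S^c}(\cdot|a_{S^c},\lambda)$ are conditional probability distributions. Correlations are called genuinely multipartite nonlocal if they are not of the displayed form; a genuinely multipartite Bell inequality is an inequality on correlations satisfied by all correlations of the displayed form. The particle-number superselection rule allows only local measurements whose elements commute with the local particle-number operator. *)

(* Defs.v *)
From HB Require Import structures.
From mathcomp Require Import all_boot all_order all_algebra.
From mathcomp Require Import all_classical all_reals all_analysis.
From mathcomp Require Import complex.

Set Implicit Arguments.
Unset Strict Implicit.
Unset Printing Implicit Defensive.

Import Order.TTheory GRing.Theory Num.Theory.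

Local Open Scope classical_set_scope.
Local Open Scope ring_scope.
Local Open Scope complex_scope.

Inductive statistics := Boson | Fermion.

(* Orthonormal basis of the Fock space of d modes: occupation-number vectors,
   restricted by the Pauli principle for fermions. *)
Definition occupation_allowed (s : statistics) (d : nat)
    (n : {ffun 'I_d -> nat}) : bool :=
  if s is Fermion then [forall i, (n i <= 1)%N] else true.

Definition fock (s : statistics) (d : nat) : countType :=
  {n : {ffun 'I_d -> nat} | occupation_allowed s n}.

Definition particles (s : statistics) (d : nat) (n : fock s d) : nat :=
  (\sum_(i < d) val n i)%N.

(* Basis of the tensor product, over the parties j, of the local Fock spaces
   of d j modes. *)
Definition global_fock (s : statistics) (N : nat) (d : 'I_N -> nat)
    : choiceType :=
  {dffun forall j : 'I_N, fock s (d j)}.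

Definition total_particles (s : statistics) (N : nat) (d : 'I_N -> nat)
    (n : global_fock s d) : nat :=
  (\sum_(j < N) particles (n j))%N.

(* An operator is given by its matrix elements A n m = <n|A|m> in the
   orthonormal basis T, which may be infinite.  The sums in [opmul] and
   [optrace] have the intended meaning when their support is finite; this is
   so below, where one factor is diagonal or supported on the finitely many
   configurations with a fixed total particle number. *)
Definition operator (R : realType) (T : choiceType) := T -> T -> R[i].

Definition opid (R : realType) (T : choiceType) : operator R T :=
  fun n m => (n == m)%:R.

Definition opmul (R : realType) (T : choiceType) (A B : operator R T)
    : operator R T :=
  fun n m => \sum_(k \in [set: T]) A n k * B k m.

Definition optrace (R : realType) (T : choiceType) (A : operator R T) : R[i] :=
  \sum_(n \in [set: T]) A n n.

Definition number_operator (R : realType) (T : choiceType) (num : T -> nat)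
    : operator R T :=
  fun n m => (num n)%:R * (n == m)%:R.

(* <v|A|v> >= 0 for all finite linear combinations v of basis vectors; on R[i],
   0 <= z means that z is real and nonnegative. *)
Definition positive_operator (R : realType) (T : choiceType)
    (A : operator R T) : Prop :=
  forall (r : seq T) (v : T -> R[i]),
    0 <= \sum_(n <- r) \sum_(m <- r) (v n)^* * A n m * v m.

(* Positivity and summation to the identity force 0 <= E x <= 1, so such
   matrix elements are exactly those of a POVM of bounded operators. *)
Definition povm (R : realType) (T : choiceType) (X : finType)
    (E : X -> operator R T) : Prop :=
  (forall x, positive_operator (E x)) /\
  (forall n m, \sum_(x : X) E x n m = opid R n m).

(* Density operator rho with Ntot rho = M rho, Ntot being the total particle
   number. *)
Definition state_of_particles (R : realType) (s : statistics) (N : nat)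
    (d : 'I_N -> nat) (M : nat) (rho : operator R (global_fock s d)) : Prop :=
  [/\ positive_operator rho,
      optrace rho = 1 &
      forall n m, opmul (number_operator R (@total_particles s N d)) rho n m
                  = M%:R * rho n m].

Definition obeys_number_superselection (R : realType) (s : statistics)
    (d : nat) (A : operator R (fock s d)) : Prop :=
  forall n m, opmul A (number_operator R (@particles s d)) n m
              = opmul (number_operator R (@particles s d)) A n m.

(* For fermions this is also the product of the corresponding local
   observables: number-conserving operators are even, so no signs appear when
   they act across parties. *)
Definition tensor_operator (R : realType) (s : statistics) (N : nat)
    (d : 'I_N -> nat) (A : forall j : 'I_N, operator R (fock s (d j)))
    : operator R (global_fock s d) :=
  fun n m => \prod_(j < N) A j (n j) (m j).

Definition joint (N : nat) (X : 'I_N -> finType) : finType :=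
  {dffun forall j : 'I_N, X j}.

Definition subjoint (N : nat) (X : 'I_N -> finType) (S : {set 'I_N})
    : finType :=
  {dffun forall j : {i : 'I_N | i \in S}, X (val j)}.

Definition party_restrict (N : nat) (X : 'I_N -> finType) (S : {set 'I_N})
    (x : joint X) : subjoint X S :=
  [ffun j : {i : 'I_N | i \in S} => x (val j)].

(* p x a is p(x|a). *)
Definition correlations (R : realType) (N : nat) (X A : 'I_N -> finType) :=
  joint X -> joint A -> R.

(* Tr[rho (x)_j E_j] *)
Definition born (R : realType) (s : statistics) (N : nat) (d : 'I_N -> nat)
    (X A : 'I_N -> finType) (rho : operator R (global_fock s d))
    (E : forall j : 'I_N, A j -> X j -> operator R (fock s (d j)))
    (x : joint X) (a : joint A) : R[i] :=
  optrace (opmul rho (tensor_operator (fun j => E j (a j) (x j)))).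

Definition nontrivial_part (N : nat) (S : {set 'I_N}) : bool :=
  (S != finset.set0) && (S \proper [set: 'I_N]%SET).

(* A conditional distribution of the outcomes of the parties in S given their
   settings and the hidden variable; nothing is required inside S, so
   signalling between the parties of S is allowed. *)
Definition conditional_distribution (R : realType) (N : nat)
    (X A : 'I_N -> finType) (S : {set 'I_N}) (disp : measure_display)
    (L : measurableType disp) (p : subjoint X S -> subjoint A S -> L -> R)
    : Prop :=
  [/\ forall x a l, 0 <= p x a l,
      forall a l, \sum_(x : subjoint X S) p x a l = 1 &
      forall x a, measurable_fun [set: L] (p x a)].

(* The form sum_S q_S int dl rho_S(l) p_S(x_S|a_S,l) p_{S^c}(x_{S^c}|a_{S^c},l);
   the distribution rho_S is the probability measure mu S. *)
Definition bipartition_local (R : realType) (N : nat) (X A : 'I_N -> finType)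
    (P : correlations R X A) : Prop :=
  exists (disp : measure_display) (L : measurableType disp)
    (q : {set 'I_N} -> R) (mu : {set 'I_N} -> probability L R)
    (p : forall S : {set 'I_N}, subjoint X S -> subjoint A S -> L -> R),
    [/\ forall S, nontrivial_part S -> 0 <= q S,
        \sum_(S : {set 'I_N} | nontrivial_part S) q S = 1,
        forall S, nontrivial_part S -> conditional_distribution (p S) &
        forall x a, P x a =
          \sum_(S : {set 'I_N} | nontrivial_part S)
            q S * \int[mu S]_l
              (p S (party_restrict S x) (party_restrict S a) l *
               p (~: S)%SET (party_restrict (~: S)%SET x)
                 (party_restrict (~: S)%SET a) l)].

(* The inequality I(P) <= b on correlations. *)
Definition genuinely_multipartite_bell_inequality (R : realType) (N : nat)
    (X A : 'I_N -> finType) (I : correlations R X A -> R) (b : R) : Prop :=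
  forall P, bipartition_local P -> I P <= b.

(* Main.v *)
Require Import Defs.
From mathcomp Require Import all_boot all_order all_algebra.
From mathcomp Require Import all_classical all_reals all_analysis.
From mathcomp Require Import complex ring.
From mathcomp Require Import spectral.

(* Each configuration of M < N particles leaves some party empty; let j be the
   first one.  Number-conserving measurements do not change the local particle
   numbers, so they only connect configurations with the same j, and on such a
   pair the factor of party j is its vacuum probability.  Grouping the trace by j
   gives p(x|a) = sum_j v_j(x_j|a_j) R_j(x_k, k <> j | a_k, k <> j), where R_j is
   nonnegative by the Schur product theorem and sums over outcomes to the
   weight Q_j that the state puts on the configurations of class j.  Hence
   v_j and R_j / Q_j form a local model for the bipartition {j} | {j}^c, used
   with probability Q_j. *)

Set Implicit Arguments.
Unset Strict Implicit.
Unset Printing Implicit Defensive.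

Import Order.TTheory GRing.Theory Num.Theory.
Local Open Scope ring_scope.

(** * Positive semidefinite matrices as Gram matrices *)

Section Gram.
Variable C : numClosedFieldType.

(** Positive semidefiniteness recorded by a factorization of [A] as the adjoint of [B] times [B], a
    form in which entrywise products are easy to handle. *)
Definition gram (I : Type) (A : I -> I -> C) : Prop :=
  exists (K : finType) (B : K -> I -> C),
    forall i j, A i j = \sum_k (B k i)^* * B k j.

Lemma sum_delta (I : finType) (F : I -> C) (i : I) :
  \sum_k F k * (k == i)%:R = F i.
Proof.
rewrite (bigD1 i) //= eqxx mulr1 big1 ?addr0 // => k /negPf ->.
by rewrite mulr0.
Qed.

(** Polarization: on the vector equal to 1 at [i] plus [c] at [j] the form is real, and so are its
    diagonal terms, hence also its cross terms. Taking [c = 1] makes [A i j + A j i] real, and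
    [c = 'i] makes [A i j - A j i] purely imaginary. *)
Lemma form_hermitian (I : finType) (A : I -> I -> C) :
  (forall v : I -> C, 0 <= \sum_i \sum_j (v i)^* * A i j * v j) ->
  forall i j, A j i = (A i j)^*.
Proof.
move=> posA i j.
have dual (c : C) (F : I -> C) :
    \sum_k F k * ((k == i)%:R + c * (k == j)%:R) = F i + F j * c.
  under eq_bigr => k _ do rewrite mulrDr mulrA.
  by rewrite big_split /= !sum_delta.
have form2 (c : C) :
    0 <= A i i + A i j * c + (A j i + A j j * c) * c^*.
  have := posA (fun k => (k == i)%:R + c * (k == j)%:R).
  under eq_bigr => k _ do rewrite dual -mulrA -mulrDr mulrC rmorphD rmorphM
    /= !conjC_nat.
  by rewrite (dual c^* (fun k => A k i + A k j * c)).
have diag k : A k k \is Num.real.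
  apply: ger0_real; have := posA (fun l => (l == k)%:R).
  under eq_bigr => l _ do rewrite sum_delta conjC_nat mulrC.
  by rewrite sum_delta.
have cross (c : C) : (A i j * c + A j i * c^*)^* = A i j * c + A j i * c^*.
  apply/CrealP.
  have -> : A i j * c + A j i * c^* =
      A i i + A i j * c + (A j i + A j j * c) * c^* - (A i i + A j j * (c * c^*)).
    by ring.
  by rewrite rpredB ?(ger0_real (form2 c)) // rpredD // rpredM // ger0_real
    ?mul_conjC_ge0.
have := cross 1; rewrite conjC1 !mulr1 rmorphD /= => E1.
have := cross 'i; rewrite conjCi !mulrN rmorphB /= !rmorphM /= conjCi.
rewrite !mulrN opprK => E2.
have {}E2 : (A j i)^* - (A i j)^* = A i j - A j i.
  by apply: (mulIf (neq0Ci C)); rewrite !mulrBl -E2 addrC.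
have two0 : 2%:R != 0 :> C by rewrite pnatr_eq0.
apply: (mulfI two0).
have -> : 2%:R * A j i = A i j + A j i - (A i j - A j i) by ring.
by rewrite -E1 -E2; ring.
Qed.

(** Spectral theorem: [A] is diagonalized by a unitary [P] with nonnegative eigenvalues [D], and the
    factor is the square root of [D] times [P]. *)
Lemma form_gram (I : finType) (A : I -> I -> C) :
  (forall v : I -> C, 0 <= \sum_i \sum_j (v i)^* * A i j * v j) -> gram A.
Proof.
move=> posA.
pose M : 'M[C]_#|I| := \matrix_(i, j) A (enum_val i) (enum_val j).
have hM : M \is hermsymmx.
  apply/is_hermitianmxP; rewrite expr0 scale1r; apply/matrixP => i j.
  by rewrite !mxE; apply: form_hermitian.
have := orthomx_spectralP (hermitian_normalmx hM).
have unitP := spectral_unitarymx M.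
set P := spectralmx M; set D := spectral_diag M => defM.
rewrite invmx_unitary // in defM.
have D_ge0 k : 0 <= D 0 k.
  (* The test vector is the conjugate of row [k] of [P], an eigenvector on which the form takes the
     value [D 0 k]. *)
  have := posA (fun i => (P k (enum_rank i))^*).
  congr (_ <= _).
  have -> : D = \row_i (P *m M *m (P ^t*)%sesqui) i i.
    apply/rowP => i; rewrite mxE defM !mulmxA mulmxtVK // (unitarymxP unitP).
    by rewrite mul1mx mxE eqxx mulr1n.
  rewrite mxE mxE exchange_big (reindex _ (onW_bij _ (enum_val_bij I))) /=.
  apply: eq_bigr => j _.
  rewrite !mxE mulr_suml (reindex _ (onW_bij _ (enum_val_bij I))) /=.
  by apply: eq_bigr => i _; rewrite !mxE !enum_valK conjCK.
exists 'I_#|I|, (fun k i => sqrtC (D 0 k) * P k (enum_rank i)) => i j.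
have -> : A i j = M (enum_rank i) (enum_rank j) by rewrite mxE !enum_rankK.
rewrite defM mul_mx_diag mxE; apply: eq_bigr => k _; rewrite !mxE.
have DE : (sqrtC (D 0 k))^* * sqrtC (D 0 k) = D 0 k.
  by rewrite (CrealP _) -?expr2 ?sqrtCK // ger0_real // sqrtC_ge0.
by rewrite rmorphM /= mulrACA DE mulrCA mulrA.
Qed.

Lemma gram_tr (I : Type) (A : I -> I -> C) : gram A -> gram (fun i j => A j i).
Proof.
move=> [K [B AE]]; exists K, (fun k i => (B k i)^*) => i j.
by rewrite AE; apply: eq_bigr => k _; rewrite conjCK mulrC.
Qed.

Lemma gram1 (I : Type) : gram (fun _ _ : I => 1).
Proof.
exists unit, (fun _ _ => 1) => i j.
by rewrite big_const card_unit /= conjC1 mulr1 addr0.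
Qed.

(** Schur product theorem: the products of one row of each factor are the rows of a factor of the
    entrywise product. *)
Lemma gramM (I : Type) (A A' : I -> I -> C) :
  gram A -> gram A' -> gram (fun i j => A i j * A' i j).
Proof.
move=> [K [B AE]] [K' [B' AE']].
exists (K * K')%type, (fun k i => B k.1 i * B' k.2 i) => i j.
rewrite AE AE' mulr_suml -(pair_big predT predT
  (fun k l => (B k i * B' l i)^* * (B k j * B' l j))) /=.
apply: eq_bigr => k _; rewrite mulr_sumr.
by apply: eq_bigr => l _; rewrite rmorphM /= mulrACA.
Qed.

Lemma gram_prod (I : Type) (J : finType) (A : J -> I -> I -> C) :
  (forall l, gram (A l)) -> gram (fun i j => \prod_l A l i j).
Proof.
move=> gA; elim: (index_enum J) => [|l r IH].
  have [K [B E]] := gram1 I; exists K, B => i j.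
  by rewrite big_nil -E.
have [K [B E]] := gramM (gA l) IH; exists K, B => i j.
by rewrite big_cons -E.
Qed.

Lemma gram_diag_ge0 (I : Type) (A : I -> I -> C) i : gram A -> 0 <= A i i.
Proof.
move=> [K [B ->]]; apply: sumr_ge0 => k _.
by rewrite mulrC mul_conjC_ge0.
Qed.

(** The double sum is the sum over [k] of the squared moduli of the partial row sums of [B]. *)
Lemma gram_sum_ge0 (I : finType) (Q : pred I) (A : I -> I -> C) :
  gram A -> 0 <= \sum_(i | Q i) \sum_(j | Q j) A i j.
Proof.
move=> [K [B AE]].
under eq_bigr => i _ do under eq_bigr => j _ do rewrite AE.
under eq_bigr => i _ do rewrite exchange_big /=.
rewrite exchange_big /=; apply: sumr_ge0 => k _.
under eq_bigr => i _ do rewrite -mulr_sumr.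
by rewrite -mulr_suml -rmorph_sum mulrC mul_conjC_ge0.
Qed.

End Gram.

Local Open Scope complex_scope.

(** * Reduction of sums and positivity to finite index types *)

Lemma sum_dffun_prod (C : comNzRingType) (J : finType) (X : J -> finType)
    (F : forall j, X j -> C) :
  \sum_(x : {dffun forall j, X j}) \prod_j F j (x j)
  = \prod_j \sum_(y : X j) F j y.
Proof.
rewrite (reindex _ (onW_bij _ (dffun_of_fprod_bij X))) /=.
transitivity (\sum_(t : fprod X) \prod_(j in J) [ffun y => F j y] (t j)).
  by apply: eq_bigr => t _; apply: eq_bigr => j _; rewrite !ffunE.
rewrite (big_fprod _ _ (fun j => [ffun y => F j y])).
transitivity (\prod_j \sum_(u in tagged_with X j) untag 0 [ffun y => F j y] u).
  by rewrite bigA_distr_big_dep.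
apply: eq_bigr => j _; rewrite -(big_tag (fun j => [ffun y => F j y])).
by apply: eq_bigr => y _; rewrite ffunE.
Qed.

(** The map [g] need not be injective, since distinct global configurations can agree at one party;
    the coefficients of [v] are therefore added up along the fibres of [g]. *)
Lemma positive_operator_gram (R : realType) (T : choiceType)
    (A : operator R T) (I : finType) (g : I -> T) :
  positive_operator A -> gram (fun i j => A (g i) (g j)).
Proof.
move=> posA; apply: form_gram => v.
pose w t := \sum_(i | g i == t) v i.
pose r := undup [seq g i | i <- enum I].
have mem_r i : g i \in r by rewrite mem_undup map_f // mem_enum.
have fibre (F : T -> R[i]) : \sum_(t <- r) F t * w t = \sum_i F (g i) * v i.
  under eq_bigr => t _ do rewrite mulr_sumr.
  rewrite (exchange_big_dep predT) //=; apply: eq_bigr => i _.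
  rewrite big_mkcond (bigD1_seq (g i)) ?mem_r ?undup_uniq //= eqxx.
  by rewrite big1 ?addr0 // => t; rewrite eq_sym => /negPf ->.
have := posA r w; congr (_ <= _).
under eq_bigr => n _ do rewrite fibre.
rewrite exchange_big [RHS]exchange_big /=; apply: eq_bigr => j _.
(* Conjugation moves the bar off the weights [w n], so that [fibre] applies to the remaining sum as
   well. *)
rewrite -[RHS]conjcK -[LHS]conjcK; congr (_^*).
rewrite !rmorph_sum /=.
transitivity (\sum_(n <- r) (A n (g j) * v j)^* * w n).
  by apply: eq_bigr => n _; rewrite !rmorphM /= conjcK -mulrA mulrC.
by rewrite fibre; apply: eq_bigr => n _; rewrite !rmorphM /= conjcK -mulrA mulrC.
Qed.

Lemma fsbig_fin (V : nmodType) (T : choiceType) (I : finType) (g : I -> T)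
    (F : T -> V) :
  injective g -> (forall t, (forall i, g i <> t) -> F t = 0) ->
  \sum_(t \in [set: T]) F t = \sum_i F (g i).
Proof.
move=> g_inj F0; pose r := [seq g i | i <- enum I].
rewrite -(fsbig_widen [set` r]) //; last first.
  move=> t [_ /= tr]; apply: F0 => i git.
  by apply: tr; rewrite -git map_f // mem_enum.
rewrite -fsbig_seq; first by rewrite big_map big_enum.
by rewrite map_inj_uniq // enum_uniq.
Qed.

(** * Number operators, superselection and fixed-number configurations *)

Section Number.
Variables (R : realType) (T : choiceType) (num : T -> nat).
Implicit Type A : operator R T.

Lemma opmul_number_operator A n m :
  opmul A (number_operator R num) n m = A n m * (num m)%:R.
Proof.
rewrite /opmul (@fsbig_fin _ _ unit (fun=> m)) ?big_const ?card_unit /=; first last.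
- move=> t /(_ tt) mt; rewrite /number_operator.
  by case: eqP => [tm|_]; [case: mt | rewrite !mulr0].
- by move=> [] [].
by rewrite /number_operator eqxx mulr1 addr0.
Qed.

Lemma number_operator_opmul A n m :
  opmul (number_operator R num) A n m = (num n)%:R * A n m.
Proof.
rewrite /opmul (@fsbig_fin _ _ unit (fun=> n)) ?big_const ?card_unit /=; first last.
- move=> t /(_ tt) nt; rewrite /number_operator.
  by case: eqP => [//|_]; rewrite mulr0 mul0r.
- by move=> [] [].
by rewrite /number_operator eqxx mulr1 addr0.
Qed.

End Number.

(** The [n], [m] entry of the commutator with the number operator is [A n m] times the difference of
    the particle numbers. *)
Lemma superselection_block (R : realType) (s : statistics) (d : nat)
    (A : operator R (fock s d)) n m :
  obeys_number_superselection A -> particles n != particles m -> A n m = 0.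
Proof.
move=> /(_ n m); rewrite opmul_number_operator number_operator_opmul mulrC.
move=> /eqP; rewrite -subr_eq0 -mulrBl mulf_eq0 subr_eq0 eqr_nat eq_sym.
by case: eqP => //= _ /eqP.
Qed.

Lemma state_support (R : realType) (s : statistics) (N : nat)
    (d : 'I_N -> nat) (M : nat) (rho : operator R (global_fock s d)) n m :
  state_of_particles M rho -> total_particles n != M -> rho n m = 0.
Proof.
move=> [_ _ /(_ n m)]; rewrite number_operator_opmul => /eqP.
rewrite -subr_eq0 -mulrBl mulf_eq0 subr_eq0 eqr_nat.
by case: eqP => //= _ /eqP.
Qed.

(** With [M] particles in all, no occupation number exceeds [M], so truncation to ['I_M.+1] is
    injective on these configurations; its image serves as index type. *)
Lemma finite_configurations (s : statistics) (N : nat) (d : 'I_N -> nat)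
    (M : nat) :
  exists (I : finType) (g : I -> global_fock s d),
    [/\ injective g, forall i, total_particles (g i) = M &
        forall n, total_particles n = M -> exists i, g i = n].
Proof.
pose J : finType := {dffun forall j : 'I_N, {ffun 'I_(d j) -> 'I_M.+1}}.
pose f (n : global_fock s d) : J :=
  [ffun j : 'I_N => [ffun i : 'I_(d j) => inord (val (n j) i)]].
have f_inj n m : total_particles n = M -> total_particles m = M ->
    f n = f m -> n = m.
  have bound k j i : total_particles k = M -> (val (k j) i < M.+1)%N.
    move=> <-; rewrite ltnS /total_particles (bigD1 j) //= /particles.
    by rewrite (bigD1 i) //= -addnA leq_addr.
  move=> nM mM /ffunP fnm; apply/ffunP => j; apply/val_inj/ffunP => i.
  have := fnm j; rewrite !ffunE => /ffunP /(_ i); rewrite !ffunE.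
  by move=> /(congr1 val); rewrite /= !inordK ?bound.
pose hit (c : J) := `[< exists n, total_particles n = M /\ f n = c >].
have hitP (c : {c : J | hit c}) :
    {n | total_particles n = M /\ f n = val c}.
  by apply: cid; apply/asboolP; exact: (valP c).
exists {c : J | hit c}, (fun c => sval (hitP c)); split.
- move=> c c' /= gcc; apply: val_inj.
  by rewrite -(svalP (hitP c)).2 -(svalP (hitP c')).2 gcc.
- by move=> c; exact: (svalP (hitP c)).1.
- move=> n nM; have hn : hit (f n) by apply/asboolP; exists n.
  exists (exist (fun c => is_true (hit c)) _ hn); apply: f_inj => //.
    exact: (svalP (hitP _)).1.
  by rewrite (svalP (hitP _)).2.
Qed.

(** * Decomposition of the correlations by the first empty party *)

Section VacuumDecomposition.
Variables (R : realType) (s : statistics) (N M : nat) (d : 'I_N -> nat).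
Variables (rho : operator R (global_fock s d)) (A X : 'I_N -> finType).
Variable E : forall j : 'I_N, A j -> X j -> operator R (fock s (d j)).
Hypotheses (hM : (M < N)%N) (hrho : state_of_particles M rho).
Hypothesis hE : forall (j : 'I_N) (a : A j), povm (E a).
Hypothesis hSSR : forall (j : 'I_N) (a : A j) (x : X j),
  obeys_number_superselection (E a x).
Variables (I : finType) (g : I -> global_fock s d).
Hypotheses (g_inj : injective g) (gM : forall i, total_particles (g i) = M).
Hypothesis g_onto : forall n, total_particles n = M -> exists i, g i = n.

Lemma vacuum_allowed (j : 'I_N) :
  occupation_allowed s ([ffun => 0%N] : {ffun 'I_(d j) -> nat}).
Proof. by case: s => //=; apply/forallP => i; rewrite ffunE. Qed.

Definition vacuum (j : 'I_N) : fock s (d j) := Sub _ (vacuum_allowed j).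

Lemma particles0 (j : 'I_N) (n : fock s (d j)) :
  particles n = 0%N -> n = vacuum j.
Proof.
move=> /eqP; rewrite sum_nat_eq0 => /forallP n0.
by apply/val_inj/ffunP => i; rewrite ffunE; apply/eqP; apply: n0.
Qed.

Definition vacuum_party (i : I) : option 'I_N :=
  [pick j | particles (g i j) == 0%N].

(** Pigeonhole: if every party held a particle, the total would be at least [N]. *)
Lemma vacuum_party_exists i : exists j, vacuum_party i = Some j.
Proof.
rewrite /vacuum_party; case: pickP => [j _|none]; first by exists j.
have : (N <= M)%N; last by rewrite leqNgt hM.
rewrite -(gM i) -[X in (X <= _)%N]card_ord -sum1_card.
by apply: leq_sum => j _; rewrite lt0n none.
Qed.

Lemma vacuum_partyP i j : vacuum_party i = Some j -> g i j = vacuum j.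
Proof.
by rewrite /vacuum_party; case: pickP => // k /eqP k0 [<-]; apply: particles0.
Qed.

Definition weight (j : 'I_N) : R[i] :=
  \sum_(l | vacuum_party l == Some j) rho (g l) (g l).

Definition vacuum_prob (j : 'I_N) (a : A j) (x : X j) : R[i] :=
  E a x (vacuum j) (vacuum j).

(** The indices of [E] are swapped relative to [rho], as in a trace of a product. The set [T] is
    free, although [~: [set j]] is the case of interest, so that [local_model] can use this at any
    [T] without a cast. *)
Definition rest_prob (j : 'I_N) (T : {set 'I_N})
    (x : subjoint X T) (a : subjoint A T) : R[i] :=
  \sum_(l | vacuum_party l == Some j) \sum_(m | vacuum_party m == Some j)
    rho (g l) (g m) *
    \prod_(i : {i | i \in T}) E (a i) (x i) (g m (val i)) (g l (val i)).

Lemma vacuum_prob_ge0 j (a : A j) (x : X j) : 0 <= vacuum_prob a x.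
Proof.
have gE := positive_operator_gram (fun _ : unit => vacuum j) ((hE a).1 x).
exact: (gram_diag_ge0 tt gE).
Qed.

Lemma sum_vacuum_prob (T : {set 'I_N}) (a : subjoint A T) :
  \sum_(x : subjoint X T) \prod_(i : {i | i \in T}) vacuum_prob (a i) (x i) = 1.
Proof.
rewrite (sum_dffun_prod (fun i y => vacuum_prob (a i) y)) big1 // => i _.
by rewrite (hE (a i)).2 /opid eqxx.
Qed.

Lemma weight_ge0 j : 0 <= weight j.
Proof.
have [rho_pos _ _] := hrho.
apply: sumr_ge0 => l _.
exact: (gram_diag_ge0 l (positive_operator_gram g rho_pos)).
Qed.

(** The summand is an entrywise product of the Gram matrix of [rho] with transposed Gram matrices of
    the local effects. *)
Lemma rest_prob_ge0 j T (x : subjoint X T) a : 0 <= rest_prob j x a.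
Proof.
have [rho_pos _ _] := hrho.
apply: gram_sum_ge0; apply: gramM; first exact: positive_operator_gram.
apply: (gram_prod (A := fun i l m => E (a i) (x i) (g m (val i)) (g l (val i)))).
move=> i.
apply: (gram_tr (A := fun l m => E (a i) (x i) (g l (val i)) (g m (val i)))).
exact: (positive_operator_gram (fun l => g l (val i)) ((hE (a i)).1 (x i))).
Qed.

Lemma sum_weight : \sum_j weight j = 1.
Proof.
have [_ <- _] := hrho.
rewrite /optrace (fsbig_fin g_inj); last first.
  move=> n gn; apply: (state_support _ hrho).
  by apply/eqP => /g_onto [l]; apply: gn.
rewrite (exchange_big_dep predT) //=; apply: eq_bigr => l _.
have [j vj] := vacuum_party_exists l.
by rewrite vj (big_pred1 j) // => k; rewrite /= eq_sym.
Qed.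

(** Summing over outcomes turns each effect into the identity. Distinct configurations of class [j]
    are both empty at [j], so they differ at another party, whose identity factor kills the
    off-diagonal term. *)
Lemma sum_rest_prob j (a : subjoint A (~: [set j])) :
  \sum_(x : subjoint X (~: [set j])) rest_prob j x a = weight j.
Proof.
rewrite exchange_big /=; apply: eq_bigr => l /eqP lj.
rewrite exchange_big /= (bigD1 l) ?lj //=.
rewrite [X in _ + X]big1 ?addr0 => [|m /andP [/eqP mj ml]].
  rewrite -mulr_sumr.
  rewrite (sum_dffun_prod (fun i y => E (a i) y (g l (val i)) (g l (val i)))).
  by rewrite big1 ?mulr1 // => i _; rewrite (hE (a i)).2 /opid eqxx.
rewrite -mulr_sumr.
rewrite (sum_dffun_prod (fun i y => E (a i) y (g m (val i)) (g l (val i)))).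
apply/eqP; rewrite mulf_eq0; apply/orP; right.
have /existsP [k kml] : [exists k, g m k != g l k].
  rewrite -negb_forall; apply: contra ml => /forallP ml.
  by apply/eqP/g_inj/ffunP => k; apply/eqP/ml.
have kj : k \in ~: [set j].
  rewrite !inE; apply: contraNneq kml => ->.
  by rewrite (vacuum_partyP lj) (vacuum_partyP mj).
pose i : {i | i \in ~: [set j]} := exist _ k kj.
by rewrite (bigD1 i) // (hE (a i)).2 /opid (negPf kml) /= mul0r.
Qed.

Lemma weight0_rest_prob j (x : subjoint X (~: [set j])) a :
  weight j = 0 -> rest_prob j x a = 0.
Proof.
move=> /eqP; rewrite -(sum_rest_prob a) psumr_eq0; last first.
  by move=> y _; apply: rest_prob_ge0.
by move=> /allP /(_ x (mem_index_enum x)) /eqP.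
Qed.

Lemma tensor_block (x : joint X) (a : joint A) (n m : global_fock s d) j :
  particles (n j) != particles (m j) ->
  \prod_(i < N) E (a i) (x i) (n i) (m i) = 0.
Proof.
move=> nm; rewrite (bigD1 j) //= (superselection_block (hSSR (a j) (x j)) nm).
by rewrite mul0r.
Qed.

Lemma born_decomposition (x : joint X) (a : joint A) :
  born rho E x a = \sum_j vacuum_prob (a j) (x j) *
    rest_prob j (party_restrict (~: [set j]) x) (party_restrict (~: [set j]) a).
Proof.
rewrite /born /optrace (fsbig_fin g_inj); last first.
  move=> n gn; rewrite /opmul fsbig1 // => k _.
  rewrite (state_support _ hrho) ?mul0r //.
  by apply/eqP => /g_onto [l]; apply: gn.
under eq_bigr => l _.
  rewrite /opmul (fsbig_fin g_inj); last first.
    move=> k gk; rewrite /tensor_operator.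
    (* If all local particle numbers agreed with those of [g l], then [k] would have [M] particles
       and be some [g m]. *)
    have /existsP [j kj] : [exists j, particles (k j) != particles (g l j)].
      rewrite -negb_forall; apply/forallP => kl.
      have /g_onto [m] : total_particles k = M; last exact: gk.
      by rewrite -(gM l); apply: eq_bigr => j _; apply/eqP/kl.
    by rewrite (tensor_block x a kj) mulr0.
  over.
under [RHS]eq_bigr => j _ do rewrite mulr_sumr.
rewrite [RHS](exchange_big_dep predT) //=; apply: eq_bigr => l _.
have [j lj] := vacuum_party_exists l.
rewrite lj (big_pred1 j) => [|k]; last by rewrite /= eq_sym.
rewrite mulr_sumr [RHS]big_mkcond; apply: eq_bigr => m _ /=.
rewrite /tensor_operator; case: eqP => [mj|mj].
  rewrite (bigD1 j) //= (vacuum_partyP lj) (vacuum_partyP mj) mulrCA.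
  congr (_ * (_ * _)).
  rewrite (eq_bigl (mem (~: [set j]))) => [|i]; last by rewrite !inE.
  rewrite big_sub; apply: eq_bigr => i _; rewrite !ffunE //.
(* Different first empty parties force different particle numbers at some party, and superselection
   makes the factor there vanish. *)
have /existsP [k kml] : [exists k, particles (g m k) != particles (g l k)].
  rewrite -negb_forall; apply/forallP => ml; apply: mj.
  by rewrite -lj; apply: eq_pick => i /=; rewrite (eqP (ml i)).
by rewrite (tensor_block x a kml) mulr0.
Qed.

(* The hidden variable names the vacuum party [l].  It is what separates the
   two roles of a singleton when [N = 2]: [~: [set l]] is then a singleton
   too.  The value when [weight l = 0] is irrelevant. *)
Definition local_model (T : {set 'I_N}) (x : subjoint X T) (a : subjoint A T)
    (l : nat) : R[i] :=
  if [pick j : 'I_N | [&& val j == l, T == ~: [set j] & weight j != 0]]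
    is Some j then rest_prob j x a / weight j
  else \prod_(i : {i | i \in T}) vacuum_prob (a i) (x i).

Lemma local_model_ge0 T (x : subjoint X T) a l : 0 <= local_model x a l.
Proof.
rewrite /local_model; case: pickP => [j _|_].
  by rewrite divr_ge0 ?rest_prob_ge0 ?weight_ge0.
by apply: prodr_ge0 => i _; apply: vacuum_prob_ge0.
Qed.

Lemma sum_local_model T (a : subjoint A T) l :
  \sum_(x : subjoint X T) local_model x a l = 1.
Proof.
rewrite /local_model; case: pickP => [j /and3P [_ /eqP T_j wj]|_].
  by subst T; rewrite -mulr_suml sum_rest_prob divff.
exact: sum_vacuum_prob.
Qed.

Lemma local_model_vacuum j (x : joint X) (a : joint A) :
  local_model (party_restrict [set j] x) (party_restrict [set j] a) j
  = vacuum_prob (a j) (x j).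
Proof.
rewrite /local_model; case: pickP => [k /and3P [/eqP/val_inj -> /eqP/setP/(_ j)]|_].
  by rewrite !inE eqxx.
transitivity (\prod_(i in [set j]) vacuum_prob (a i) (x i)).
  by rewrite [RHS]big_sub; apply: eq_bigr => i _; rewrite !ffunE.
by rewrite big_set1.
Qed.

(** The default value taken by [local_model] at zero weight is harmless, because [rest_prob] then
    vanishes too. *)
Lemma local_model_rest j (x : subjoint X (~: [set j])) a :
  weight j * local_model x a j = rest_prob j x a.
Proof.
have [w0|w0] := eqVneq (weight j) 0.
  by rewrite w0 mul0r weight0_rest_prob.
rewrite /local_model; case: pickP => [k /and3P [/eqP/val_inj -> _ _]|].
  by rewrite mulrC divfK.
by move=> /(_ j); rewrite !eqxx w0.
Qed.

End VacuumDecomposition.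

(** * Assembly of the local hidden-variable model *)

Lemma sum_singletons (V : comPzSemiRingType) (N : nat) (w : 'I_N -> V)
    (G : {set 'I_N} -> V) :
  (2 <= N)%N ->
  \sum_(S : {set 'I_N} | nontrivial_part S) (\sum_(j | S == [set j]) w j) * G S
  = \sum_j w j * G [set j].
Proof.
move=> N2; under eq_bigr => S _ do rewrite mulr_suml.
rewrite (exchange_big_dep predT) //=; apply: eq_bigr => j _.
rewrite (big_pred1 [set j]) // => S /=; rewrite andbC.
case: eqP => //= ->; rewrite /nontrivial_part -card_gt0 cards1 /=.
by rewrite properEcard finset.subsetT cards1 cardsT card_ord.
Qed.

Lemma Re_ge0 (R : realType) (z : R[i]) : 0 <= z -> (complex.Re z)%:C = z.
Proof. by move=> z0; rewrite RRe_real // ger0_real. Qed.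

(** The default 0 is only taken at sets that are not singletons, which get probability zero in the
    model. *)
Definition party_of (N : nat) (S : {set 'I_N}) : nat :=
  if [pick j | S == [set j]] is Some j then val j else 0%N.

Lemma party_of_set1 (N : nat) (j : 'I_N) : party_of [set j] = j.
Proof.
rewrite /party_of; case: pickP => [k /eqP/set1_inj -> //|/(_ j)].
by rewrite eqxx.
Qed.

Lemma Rintegral_dirac (R : realType) (f : nat -> R) (l : nat) :
  (\int[dirac l : {measure set nat -> \bar R}]_k f k)%R = f l.
Proof.
rewrite /Rintegral integral_dirac //.
by rewrite diracT mul1e.
Qed.

Theorem mainTheorem4 (R : realType) (s : statistics) (N M : nat)
    (d : 'I_N -> nat) (rho : operator R (global_fock s d))
    (A X : 'I_N -> finType)
    (E : forall j : 'I_N, A j -> X j -> operator R (fock s (d j)))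
    (hN : (2 <= N)%N) (hd : forall j, (0 < d j)%N) (hM : (M < N)%N)
    (hrho : state_of_particles M rho)
    (hE : forall (j : 'I_N) (a : A j), povm (E j a))
    (hSSR : forall (j : 'I_N) (a : A j) (x : X j),
        obeys_number_superselection (E j a x)) :
  exists P : correlations R X A,
    [/\ forall x a, (P x a)%:C = born rho E x a,
        bipartition_local P &
        forall (I : correlations R X A -> R) (b : R),
          genuinely_multipartite_bell_inequality I b -> I P <= b].
Proof.
have [I [g [g_inj gM g_onto]]] := finite_configurations s d M.
pose P : correlations R X A := fun x a => complex.Re (born rho E x a).
have PE x a : (P x a)%:C = born rho E x a.
  (* Taking the real part loses nothing: the decomposition exhibits the Born value as a sum of
     nonnegative terms. *)
  apply: Re_ge0; rewrite (born_decomposition hM hrho hSSR g_inj gM g_onto).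
  apply: sumr_ge0 => j _; apply: mulr_ge0; first exact: vacuum_prob_ge0.
  exact: (rest_prob_ge0 hrho).
suff PL : bipartition_local P.
  by exists P; split=> // J b Jb; apply: Jb.
pose w j : R := complex.Re (weight rho g j).
have wE j : (w j)%:C = weight rho g j by apply/Re_ge0/(weight_ge0 hrho).
have w_ge0 j : 0 <= w j by rewrite -ler0c wE (weight_ge0 hrho).
pose p T x a l : R := complex.Re (@local_model _ _ _ _ rho A X E _ g T x a l).
have pE T x a l : (p T x a l)%:C = local_model rho E g x a l.
  by apply/Re_ge0/(local_model_ge0 hrho).
(* The bipartition of [j] against the rest has probability [w j], and its hidden variable is
   deterministically the index of [j]; all other bipartitions have probability zero. *)
exists _, nat, (fun S => \sum_(j | S == [set j]) w j),
  (fun S => dirac (party_of S)), p; split.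
- by move=> S _; apply: sumr_ge0.
- transitivity (\sum_j w j * 1).
    rewrite -(sum_singletons w (fun=> 1) hN).
    by apply: eq_bigr => S _; rewrite mulr1.
  apply: (@complexI R); rewrite rmorph_sum rmorph1 /=.
  rewrite -(sum_weight hM hrho g_inj gM g_onto).
  by apply: eq_bigr => j _; rewrite mulr1 wE.
- move=> T _; split=> [x a l|a l|x a].
  + by rewrite -ler0c pE (local_model_ge0 hrho).
  + apply: (@complexI R); rewrite rmorph_sum rmorph1 /=.
    rewrite -(sum_local_model rho hE g_inj a l).
    by apply: eq_bigr => x _; rewrite pE.
  (* Every subset of [nat] is measurable here. *)
  + by [].
- move=> x a; under eq_bigr => S _ do rewrite Rintegral_dirac.
  rewrite (sum_singletons w (fun S =>
    p S (party_restrict S x) (party_restrict S a) (party_of S) *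
    p (~: S) (party_restrict (~: S) x) (party_restrict (~: S) a) (party_of S)) hN).
  apply: (@complexI R); rewrite PE rmorph_sum /=.
  rewrite (born_decomposition hM hrho hSSR g_inj gM g_onto).
  apply: eq_bigr => j _; rewrite party_of_set1 !rmorphM /= wE !pE.
  by rewrite local_model_vacuum mulrCA (local_model_rest hrho hE g_inj).
Qed.
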